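(* Let $(m_k)_{k\ge1}$ be a sequence of positive integers with $\sum_{k=1}^\infty \frac1{m_k}=+\infty$, and let $V_k=\{1,2,\dots,m_k\}$. Then the set $C[\bar O^1,\{V_k\}]$ has Lebesgue measure $0$.
   Context: Every irrational $x\in(0,1)$ has a unique expansion $x=\sum_{n\ge1}\frac{(-1)^{n-1}}{g_1(g_1+g_2)\cdots(g_1+\dots+g_n)}$ with all $g_n\in\mathbb N$; $g_n=g_n(x)$ is the $n$-th $\bar O^1$-symbol of $x$. For a sequence $(V_k)$ of nonempty subsets of $\mathbb N$, $C[\bar O^1,\{V_k\}]$ denotes the closure in $[0,1]$ of the set of irrational $x\in(0,1)$ with $g_k(x)\in V_k$ for all $k\in\mathbb N$. *)

(* Defs.v *)
From HB Require Import structures.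
From mathcomp Require Import all_boot all_order all_algebra.
From mathcomp Require Import all_classical all_reals all_analysis.
Import Order.TTheory GRing.Theory Num.Theory.
Import numFieldNormedType.Exports.

Set Implicit Arguments.
Unset Strict Implicit.
Unset Printing Implicit Defensive.

Local Open Scope classical_set_scope.
Local Open Scope ring_scope.

(* Symbols are indexed from 0: [g k] stands for the mathematical g_(k+1), and
   likewise [V k] for V_(k+1).  Thus [O1_den g n] is g_1 + ... + g_(n+1). *)
Definition O1_den (g : nat -> nat) (n : nat) : nat := (\sum_(i < n.+1) g i)%N.

Definition O1_term (R : realType) (g : nat -> nat) (n : nat) : R :=
  (-1) ^+ n / (\prod_(j < n.+1) O1_den g j)%N%:R.

Definition O1_expansion (R : realType) (x : R) (g : nat -> nat) : Prop :=
  (forall n, (0 < g n)%N) /\ series (O1_term R g) @ \oo --> x.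

(* An irrational x in (0,1) has exactly one expansion.  The default value 0,
   which is not a legal symbol, is used only if x has no expansion. *)
Definition O1_symbol (R : realType) (x : R) : nat -> nat :=
  xget (fun=> 0%N) [set g | O1_expansion x g].

(* [0, 1] is closed in R, so the closure relative to [0, 1] is the trace on
   [0, 1] of the closure in R. *)
Definition O1_cantor (R : realType) (V : nat -> set nat) : set R :=
  `[0, 1] `&`
  closure [set x : R | [/\ irrational x, 0 < x < 1
                         & forall k, V k (O1_symbol x k)]].
Arguments O1_cantor R V : clear implicits.

(* Main.v *)
(* The first symbol g of an expansion with all denominators shifted by d sends
   its sum y to 1 - (d + g) y, the sum of the remaining symbols with shift d + g.
   Since the sums with shift d fill at most [0, 1/(d+1)], restricting the first
   symbol to 1..m costs the factor
     (d+1) sum_(1<=g<=m) 1/((d+g)(d+g+1)) = m/(d+m+1) <= m/(m+1),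
   and n steps give a finite cover by closed intervals, hence also a cover of the
   closure, of total length
     prod_(k<n) m_k/(m_k+1) <= 1/(1 + sum_(k<n) 1/m_k) -> 0. *)
Require Import Defs.
From mathcomp Require Import all_boot all_order all_algebra.
From mathcomp Require Import all_classical all_reals all_analysis.
From mathcomp Require Import measurable_realfun ring lra.
Import Order.TTheory GRing.Theory Num.Theory.
Import numFieldNormedType.Exports.
Local Open Scope classical_set_scope.
Local Open Scope ring_scope.

(** Finitely many closed intervals are required, rather than countably many, so that their union is
    closed and a cover of [A] also covers its closure. *)
Definition interval_cover (R : realType) (A : set R) (L : R) : Prop :=
  exists s : seq (R * R),
    [/\ forall p, p \in s -> p.1 <= p.2,
        \sum_(p <- s) (p.2 - p.1) <= L
      & forall x, A x -> exists2 p, p \in s & p.1 <= x <= p.2].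

Lemma interval_cover_itv (R : realType) (A : set R) (L : R) :
  0 <= L -> (forall x, A x -> 0 <= x <= L) -> interval_cover R A L.
Proof.
move=> L0 AL; exists [:: (0, L)]; split.
- by move=> p; rewrite inE => /eqP ->.
- by rewrite big_seq1 /= subr0.
- by move=> x /AL xL; exists (0, L); rewrite ?inE.
Qed.

Lemma interval_cover_bigcup (R : realType) (n : nat) (A : set R)
    (B : nat -> set R) (L : nat -> R) :
  (forall i, (i < n)%N -> interval_cover R (B i) (L i)) ->
  (forall x, A x -> exists2 i, (i < n)%N & B i x) ->
  interval_cover R A (\sum_(i < n) L i).
Proof.
elim: n A => [|n IHn] A coverB subA.
  exists [::]; split=> //; first by rewrite big_nil big_ord0.
  by move=> x /subA[].
have [|//|s [s_le s_sum s_cov]] :=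
    IHn [set x | exists2 i, (i < n)%N & B i x].
  by move=> i /ltnW; exact: coverB.
have [t [t_le t_sum t_cov]] := coverB n (ltnSn n).
exists (s ++ t); split.
- by move=> p; rewrite mem_cat => /orP[/s_le|/t_le].
- by rewrite big_cat big_ord_recr lerD.
- move=> x /subA[i]; rewrite ltnS leq_eqVlt => /predU1P[->|lt_in] Bx.
    by have [p pt xp] := t_cov _ Bx; exists p; rewrite // mem_cat pt orbT.
  have [|p ps xp] := s_cov x; first by exists i.
  by exists p; rewrite // mem_cat ps.
Qed.

Lemma interval_cover_affine (R : realType) (A : set R) (L c : R) :
  0 < c -> interval_cover R A L ->
  interval_cover R [set x | A (1 - c * x)] (L / c).
Proof.
move=> c0 [s [s_le s_sum s_cov]].
(* The map [x -> 1 - c * x] reverses order, so the preimage of an interval has its endpoints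
   swapped. *)
exists [seq ((1 - p.2) / c, (1 - p.1) / c) | p <- s]; split.
- move=> _ /mapP[p /s_le p_le ->] /=.
  by rewrite ler_pM2r ?invr_gt0// lerD2l lerN2.
- rewrite big_map /= ler_pdivlMr// mulr_suml (le_trans _ s_sum)//.
  by apply: ler_sum => p _; rewrite -mulrBl mulfVK ?gt_eqF//; lra.
- move=> x /= /s_cov[p ps /andP[px xp]].
  exists ((1 - p.2) / c, (1 - p.1) / c); first exact/mapP/(ex_intro2 _ _ p).
  by rewrite /= ler_pdivrMr// ler_pdivlMr// mulrC; apply/andP; split; lra.
Qed.

(** The finite union [U s] is closed, hence contains [closure A]; subadditivity then bounds its
    measure by the total length. *)
Lemma interval_cover_closure (R : realType) (A : set R) (L : R) :
  interval_cover R A L -> (lebesgue_measure (closure A) <= L%:E)%E.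
Proof.
move=> [s [s_le s_sum s_cov]].
pose U (t : seq (R * R)) : set R := \big[setU/set0]_(p <- t) `[p.1, p.2]%classic.
have closedU t : closed (U t).
  rewrite /U; elim/big_rec: _ => [|p B _ cB]; first exact: closed0.
  by apply: closedU => //; exact: interval_closed.
have measU t : measurable (U t) by exact: closed_measurable.
have AU : closure A `<=` U s.
  rewrite [X in _ `<=` X](closure_id (U s)).1//; apply: closure_subset => x /s_cov[p ps xp].
  by rewrite /U -bigcup_seq; exists p => //=; rewrite in_itv.
apply: (@le_trans _ _ (lebesgue_measure (U s))).
  apply: le_measure => //; rewrite inE; last exact: measU.
  by apply: closed_measurable; exact: closed_closure.
apply: (@le_trans _ _ (\sum_(p <- s) (p.2 - p.1))%:E); last by rewrite lee_fin.
elim: s s_le {s_sum s_cov AU} => [|p s IHs] s_le.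
  by rewrite /U !big_nil measure0.
rewrite /U !big_cons EFinD.
apply: le_trans (measureU2 _ _ _) _ => //; first exact: measU.
apply: leeD; last by apply: IHs => q qs; apply: s_le; rewrite inE qs orbT.
rewrite [leLHS]lebesgue_measure_itv /= lte_fin; case: ifPn => // _.
by rewrite lee_fin subr_ge0 s_le// inE eqxx.
Qed.

(* Value of a truncated expansion in which every denominator
   g_1 + ... + g_n is increased by [d]. *)
Definition offset_sum (R : realType) (d : nat) (g : nat -> nat) (n : nat) : R :=
  \sum_(i < n) (-1) ^+ i / (\prod_(j < i.+1) (d + O1_den g j))%N%:R.

(** Every term contains the factor [1 / (d + g 0)]. Once it is taken out, the later terms are those
    of the shifted sequence with offset [d + g 0] and opposite sign. *)
Lemma offset_sumS (R : realType) (d : nat) (g : nat -> nat) (n : nat) :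
  offset_sum R d g n.+1 =
  (1 - offset_sum R (d + g 0) (fun i => g i.+1) n) / (d + g 0)%:R.
Proof.
rewrite /offset_sum big_ord_recl big_ord1 /= expr0 /O1_den big_ord1.
rewrite mulrBl; congr (_ + _); rewrite mulr_suml -sumrN; apply: eq_bigr => i _.
rewrite big_ord_recl /= big_ord1 natrM invfM exprS mulN1r !mulNr; congr (- _).
rewrite mulrCA mulrC; congr (_ / _%:R * _); apply: eq_bigr => j _.
by rewrite [in LHS]big_ord_recl addnA.
Qed.

(** By induction the tail in [offset_sumS] lies in [0, 1], so the sum lies between 0 and
    [1 / (d + g 0)], where [d + g 0] is at least [d + 1]. *)
Lemma offset_sum_bounds (R : realType) (d : nat) (g : nat -> nat) (n : nat) :
  (forall i, 0 < g i)%N -> 0 <= offset_sum R d g n <= d.+1%:R^-1.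
Proof.
elim: n d g => [|n IHn] d g g_gt0.
  by rewrite /offset_sum big_ord0 lexx invr_ge0 ler0n.
have /andP[s_ge0 s_le] := IHn (d + g 0)%N _ (fun i => g_gt0 i.+1).
have s_le1 := le_trans s_le (_ : _ <= 1).
rewrite offset_sumS; apply/andP; split.
  by rewrite divr_ge0 ?ler0n// subr_ge0 s_le1// invf_le1 ?ltr0n// ler1n.
have dg : (d.+1 <= d + g 0)%N by rewrite -addn1 leq_add2l.
apply: (@le_trans _ _ (d + g 0)%:R^-1).
  by rewrite ler_piMl ?invr_ge0 ?ler0n//; lra.
by rewrite lef_pV2 ?ler_nat// posrE ltr0n ?(leq_trans _ dg).
Qed.

Definition offset_set (R : realType) (d : nat) (m : nat -> nat) : set R :=
  [set y | exists2 g : nat -> nat,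
     forall i, (0 < g i <= m i)%N & offset_sum R d g @ \oo --> y].

Lemma offset_set_bounds (R : realType) (d : nat) (m : nat -> nat) (y : R) :
  offset_set R d m y -> 0 <= y <= d.+1%:R^-1.
Proof.
move=> [g gm gy].
have g_gt0 i : (0 < g i)%N by case/andP: (gm i).
have b n := offset_sum_bounds R d g n g_gt0.
rewrite -(cvg_lim _ gy)//; apply/andP; split.
  apply: limr_ge; first exact: cvgP gy.
  by apply: nearW => n; case/andP: (b n).
apply: limr_le; first exact: cvgP gy.
by apply: nearW => n; case/andP: (b n).
Qed.

(** This is [offset_sumS] solved for the tail, in the limit. The index [i] encodes the first symbol
    [i + 1]. *)
Lemma offset_set_step (R : realType) (d : nat) (m : nat -> nat) (y : R) :
  offset_set R d m y ->
  exists2 i, (i < m 0)%N &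
    offset_set R (d + i.+1) (fun k => m k.+1) (1 - (d + i.+1)%:R * y).
Proof.
move=> [g gm gy]; have /andP[g0 gm0] := gm 0%N.
exists (g 0).-1; rewrite prednK//; exists (fun i => g i.+1) => //.
have -> : offset_sum R (d + g 0) (fun i => g i.+1) =
    (fun n => 1 - (d + g 0)%:R * offset_sum R d g n.+1).
  apply/funext => n; rewrite offset_sumS mulrCA divff ?mulr1 ?subKr//.
  by rewrite pnatr_eq0 -lt0n addn_gt0 g0 orbT.
apply: cvgB; first exact: cvg_cst.
apply: cvgM; first exact: cvg_cst.
by rewrite (cvg_shiftS (offset_sum R d g)).
Qed.

(** The summands are the differences [1/(d+i+1) - 1/(d+i+2)], so the sum telescopes to
    [1/(d+1) - 1/(d+n+1)]. *)
Lemma sum_inv_mulS (R : realType) (d n : nat) :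
  \sum_(i < n) ((d + i.+1).+1%:R^-1 / (d + i.+1)%:R : R) =
  d.+1%:R^-1 * (n%:R / (d + n).+1%:R).
Proof.
elim: n => [|n IHn]; first by rewrite big_ord0 mul0r mulr0.
rewrite big_ord_recr /= IHn addnS -!natr1 natrD.
have := ler0n R d; have := ler0n R n => n0 d0.
by field; rewrite !gt_eqF//; lra.
Qed.

(** Induction on [n] with [d] and [m] general, since fixing the first symbol changes both. *)
Lemma offset_set_cover (R : realType) (n d : nat) (m : nat -> nat) :
  interval_cover R (offset_set R d m)
    (d.+1%:R^-1 * \prod_(i < n) ((m i)%:R / (m i).+1%:R)).
Proof.
elim: n d m => [|n IHn] d m.
  rewrite big_ord0 mulr1; apply: interval_cover_itv.
    by rewrite invr_ge0 ler0n.
  exact: offset_set_bounds.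
set P : R := \prod_(i < n) ((m i.+1)%:R / (m i.+1).+1%:R).
have P0 : 0 <= P by apply: prodr_ge0 => i _; rewrite divr_ge0 ?ler0n.
have [] := interval_cover_bigcup R (m 0%N) (offset_set R d m)
  (fun i => [set y | offset_set R (d + i.+1) (fun k => m k.+1)
                       (1 - (d + i.+1)%:R * y)])
  (fun i => (d + i.+1).+1%:R^-1 * P / (d + i.+1)%:R).
- move=> i _; apply: interval_cover_affine; last exact: IHn.
  by rewrite ltr0n addnS.
- exact: offset_set_step.
move=> s [s_le s_sum s_cov]; exists s; split=> //.
(* The tail factor [P] does not depend on the first symbol, so it leaves the sum. *)
apply: le_trans s_sum _; under eq_bigr do rewrite mulrAC.
rewrite -mulr_suml sum_inv_mulS big_ord_recl /= [leRHS]mulrA ler_wpM2r//.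
rewrite ler_wpM2l ?invr_ge0 ?ler0n// ler_wpM2l ?ler0n//.
(* Dropping [d] from [d + m 0 + 1] makes the factor independent of the earlier symbols. *)
by rewrite lef_pV2 ?posrE ?ltr0n// ler_nat ltnS leq_addl.
Qed.

(** The left side does not increase with [n]: for a partial sum [s >= 0],
    [m/(m+1) * (1 + s + 1/m) <= 1 + s] amounts to [1 <= 1 + s]. *)
Lemma prod_div_succ_le (R : realType) (m : nat -> nat) (n : nat) :
  (forall k, 0 < m k)%N ->
  (\prod_(i < n) ((m i)%:R / (m i).+1%:R)) *
    (1 + series (fun k => (m k)%:R^-1) n) <= 1 :> R.
Proof.
move=> m_gt0; elim: n => [|n IHn].
  by rewrite big_ord0 mul1r /series /= big_geq// addr0.
apply: le_trans IHn; rewrite big_ord_recr /= -mulrA ler_wpM2l//.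
  by apply: prodr_ge0 => i _; rewrite divr_ge0 ?ler0n.
rewrite seriesSr; set s := series _ n.
have s0 : 0 <= s by apply: sumr_ge0 => i _; rewrite invr_ge0 ler0n.
have mn : 0 < (m n)%:R :> R by rewrite ltr0n.
rewrite mulrAC ler_pdivrMr ?ltr0n// addrA mulrDr divff ?gt_eqF// -natr1.
by nra.
Qed.

Theorem theorem4 (R : realType) (m : nat -> nat)
    (m_gt0 : forall k, (0 < m k)%N)
    (sum_dvg : series (fun k => (m k)%:R^-1 : R) @ \oo --> +oo) :
  lebesgue_measure
    (O1_cantor R (fun k => [set j | (1 <= j <= m k)%N])) = 0%E.
Proof.
set C := O1_cantor _ _.
have CE : C `<=` closure (offset_set R 0 m).
  move=> x [_]; apply: closure_subset => {}x [_ _ xm].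
  exists (O1_symbol x) => //; move: xm; rewrite /O1_symbol.
  (* The default sequence 0 is excluded because its symbols violate [1 <= j]; hence the symbols do
     form an expansion of [x]. *)
  case: xgetP => [g _ [_ gx] _|_ /(_ 0%N)//].
  apply: cvg_trans gx; apply: near_eq_cvg; apply: nearW => n.
  by rewrite /series /= big_mkord.
have mC : measurable C.
  apply: measurableI; first exact: measurable_itv.
  by apply: closed_measurable; exact: closed_closure.
apply/eqP; rewrite eq_le measure_ge0 andbT; apply/lee_addgt0Pr => e e0.
rewrite add0e.
(* With [s >= 1/e], the cover has total length at most [1/(1+s)], which is below [e]. *)
have [n] : exists n, e^-1 <= series (fun k => (m k)%:R^-1 : R) n.
  have /cvgryPge/(_ e^-1)[N _ NP] := sum_dvg.
  by exists N; apply: NP => /=.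
set s := series _ n => es.
have s0 : 0 < s by apply: lt_le_trans es; rewrite invr_gt0.
apply: le_trans (_ : (lebesgue_measure (closure (offset_set R 0 m)) <= _)%E).
  apply: le_measure => //; rewrite inE//.
  by apply: closed_measurable; exact: closed_closure.
apply: le_trans (interval_cover_closure _ _ _ (offset_set_cover R n 0 m)) _.
rewrite lee_fin invr1 mul1r.
have := prod_div_succ_le R m n m_gt0; rewrite -/s.
rewrite -ler_pdivlMr; last by lra.
move/le_trans; apply; rewrite div1r -[leRHS]invrK lef_pV2 ?posrE ?invr_gt0//; lra.
Qed.
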